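(* Let $(A[[t]],\mu_t,T_t)$, with $\mu_t=\sum_{i\geqslant0}\mu_it^i$ and $T_t=\sum_{i\geqslant0}T_it^i$, be a $1$-parameter formal deformation of a Rota-Baxter algebra $(A,\mu,T)$ of weight $\lambda$. Then $(\mu_1,T_1)$ is a $2$-cocycle in the cochain complex $\mathrm{C}^\bullet_{\mathrm{RBA}_\lambda}(A)$.
   Context: $\mathbf{k}$ is a field of characteristic $0$, $\lambda\in\mathbf{k}$; everything is over $\mathbf{k}$. A Rota-Baxter algebra of weight $\lambda$ is $(A,\mu=\cdot,T)$ with $(A,\mu)$ associative and $T:A\to A$ linear with $T(a)T(b)=T(aT(b)+T(a)b+\lambda ab)$. Write $a_{i,j}=a_i\otimes\cdots\otimes a_j$ (empty if $i>j$). **Formal deformation.** For linear maps $\mu_i:A\otimes A\to A$ and $T_i:A\to A$ ($i\geqslant0$), the pair $(\mu_t=\sum\mu_it^i,T_t=\sum T_it^i)$ is a $1$-parameter formal deformation of $(A,\mu,T)$ if (extended $\mathbf{k}[[t]]$-linearly) it makes the $\mathbf{k}[[t]]$-module $A[[t]]$ into a Rota-Baxter algebra of weight $\lambda$ over $\mathbf{k}[[t]]$ and $(\mu_0,T_0)=(\mu,T)$. **Cochain complex.** Let $\mathrm{C}^n_{\mathrm{Alg}}(A)=\mathrm{C}^n_{\mathrm{RBO}_\lambda}(A)=\mathrm{Hom}(A^{\otimes n},A)$, $n\geqslant0$. - $\delta^n(f)(a_{1,n+1})=(-1)^{n+1}a_1f(a_{2,n+1})+\sum_{i=1}^n(-1)^{n-i+1}f(a_{1,i-1}\otimes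 a_ia_{i+1}\otimes a_{i+2,n+1})+f(a_{1,n})a_{n+1}$. - With $a\star b=aT(b)+T(a)b+\lambda ab$, $a\rhd x=T(a)x-T(ax)$, $x\lhd a=xT(a)-T(xa)$: $\partial^n(f)(a_{1,n+1})=(-1)^{n+1}a_1\rhd f(a_{2,n+1})+\sum_{i=1}^n(-1)^{n-i+1}f(a_{1,i-1}\otimes a_i\star a_{i+1}\otimes a_{i+2,n+1})+f(a_{1,n})\lhd a_{n+1}$. - $\Phi^0=\mathrm{Id}$ and for $n\geqslant1$: $\Phi^n(f)(a_{1,n})=f(T(a_1)\otimes\cdots\otimes T(a_n))-\sum_{k=0}^{n-1}\lambda^{n-k-1}\sum_{1\leqslant i_1<\cdots<i_k\leqslant n}T\circ f(a_{1,i_1-1}\otimes T(a_{i_1})\otimes a_{i_1+1,i_2-1}\otimes T(a_{i_2})\otimes\cdots\otimes T(a_{i_k})\otimes a_{i_k+1,n})$. - $\mathrm{C}^0_{\mathrm{RBA}_\lambda}(A)=\mathrm{C}^0_{\mathrm{Alg}}(A)$, $\mathrm{C}^n_{\mathrm{RBA}_\lambda}(A)=\mathrm{C}^n_{\mathrm{Alg}}(A)\oplus\mathrm{C}^{n-1}_{\mathrm{RBO}_\lambda}(A)$ for $n\geqslant1$, with $d^n(f,g)=(\delta^n(f),-\partial^{n-1}(g)-\Phi^n(f))$. *)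

(* Defs.v *)
From HB Require Import structures.
From mathcomp Require Import all_boot all_order all_algebra.
From mathcomp Require Import boolp functions.

Set Implicit Arguments.
Unset Strict Implicit.
Unset Printing Implicit Defensive.

Import GRing.Theory.
Local Open Scope ring_scope.

(* A Rota-Baxter algebra of weight lambda over R; associative algebras are
   not assumed to be unital. *)
Record rota_baxter (R : comNzRingType) (A : lmodType R) (lambda : R)
    (mu : A -> A -> A) (T : A -> A) : Prop := RotaBaxter {
  rota_baxter_bilinear : bilinear_for *:%R *:%R mu;
  rota_baxter_assoc : associative mu;
  rota_baxter_linear : linear T;
  rota_baxter_eq : forall a b,
    mu (T a) (T b) = T (mu a (T b) + mu (T a) b + lambda *: mu a b) }.

(* fps V is V[[t]]: the series \sum_i v_i t^i is the sequence of its
   coefficients v_i. *)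
Definition fps (V : Type) : Type := nat -> V.

HB.instance Definition _ (V : zmodType) := GRing.Zmodule.copy (fps V) (nat -> V).

Lemma fpsP (V : Type) (x y : fps V) : (forall n, x n = y n) -> x = y.
Proof. exact: funext. Qed.

Definition cauchy (U V W : zmodType) (op : U -> V -> W)
    (x : fps U) (y : fps V) : fps W :=
  fun n => \sum_(i < n.+1) op (x i) (y (n - i)%N).

Section CauchyTheory.

Lemma cauchy_rev (U V W : zmodType) (op : U -> V -> W) x y :
  cauchy op x y = cauchy (fun v u => op u v) y x.
Proof.
apply/fpsP => n; rewrite /cauchy (reindex_inj rev_ord_inj) /=.
by apply: eq_bigr => i _; rewrite subSS subKn // -ltnS.
Qed.

Lemma cauchyDl (U V W : zmodType) (op : U -> V -> W) :
  (forall v, {morph op^~ v : u1 u2 / u1 + u2}) ->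
  forall y, {morph (cauchy op)^~ y : x1 x2 / x1 + x2}.
Proof.
move=> opD y x1 x2; apply/fpsP => n.
transitivity (cauchy op x1 y n + cauchy op x2 y n); last by [].
rewrite /cauchy -big_split /=.
by apply: eq_bigr => i _; rewrite -opD.
Qed.

Lemma cauchyDr (U V W : zmodType) (op : U -> V -> W) :
  (forall u, {morph op u : v1 v2 / v1 + v2}) ->
  forall x, {morph cauchy op x : y1 y2 / y1 + y2}.
Proof.
by move=> opD x y1 y2; rewrite !(cauchy_rev op) cauchyDl // => v; apply: opD.
Qed.

Lemma cauchyA (U V W UV VW Z : zmodType) (op1 : UV -> W -> Z)
    (op2 : U -> V -> UV) (op3 : U -> VW -> Z) (op4 : V -> W -> VW) :
  (forall w, {morph op1^~ w : x y / x + y}) ->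
  (forall u, {morph op3 u : x y / x + y}) ->
  (forall u v w, op1 (op2 u v) w = op3 u (op4 v w)) ->
  forall x y z,
    cauchy op1 (cauchy op2 x y) z = cauchy op3 x (cauchy op4 y z).
Proof.
move=> op1D op3D opA x y z; apply/fpsP => n.
have op10 w : op1 0 w = 0 by apply: (addIr (op1 0 w)); rewrite -op1D !add0r.
have op30 u : op3 u 0 = 0 by apply: (addIr (op3 u 0)); rewrite -op3D !add0r.
have op1S (I : Type) (r : seq I) (P : pred I) (F : I -> UV) w :
    op1 (\sum_(i <- r | P i) F i) w = \sum_(i <- r | P i) op1 (F i) w.
  exact: (big_morph (op1^~ w) (op1D w) (op10 w)).
have op3S (I : Type) (r : seq I) (P : pred I) (F : I -> VW) u :
    op3 u (\sum_(i <- r | P i) F i) = \sum_(i <- r | P i) op3 u (F i).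
  exact: (big_morph (op3 u) (op3D u) (op30 u)).
rewrite (cauchy_rev op1); symmetry.
pose c j k := op3 (x j) (op4 (y (n - j - k)%N) (z k)).
transitivity (\sum_(j < n.+1) \sum_(k < n.+1 | (k <= n - j)%N) c j k).
  apply: eq_bigr => /= j _; rewrite cauchy_rev op3S.
  by rewrite (big_ord_narrow_leq (leq_subr _ _)).
rewrite (exchange_big_dep predT) //=; apply: eq_bigr => k _.
transitivity (\sum_(j < n.+1 | (j <= n - k)%N) c j k).
  apply: eq_bigl => j; rewrite -ltnS -(ltnS j) -!subSn ?leq_ord //.
  by rewrite -subn_gt0 -(subn_gt0 j) -!subnDA addnC.
rewrite (big_ord_narrow_leq (leq_subr _ _)) op1S /=.
by apply: eq_bigr => j _; rewrite /c -!subnDA addnC opA.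
Qed.

End CauchyTheory.

Definition fpsC (V : zmodType) (v : V) : fps V :=
  fun n => if n is 0 then v else 0.

Lemma cauchyC (U V W : zmodType) (op : U -> V -> W) u y :
  (forall v, op 0 v = 0) -> cauchy op (fpsC u) y = fun n => op u (y n).
Proof.
move=> op0; apply/fpsP => n.
by rewrite /cauchy big_ord_recl subn0 big1 ?addr0 // => i _; exact: op0.
Qed.

Section FpsRing.
Variable R : comNzRingType.

Let fps_mulA : associative (cauchy (@GRing.mul R)).
Proof.
move=> x y z; symmetry; apply: cauchyA => [w u v|u v w|u v w] /=.
- exact: mulrDl.
- exact: mulrDr.
- by rewrite mulrA.
Qed.

Let fps_mulC : commutative (cauchy (@GRing.mul R)).
Proof.
move=> x y; rewrite cauchy_rev; apply/fpsP => n.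
by apply: eq_bigr => i _; rewrite mulrC.
Qed.

Let fps_mul1 : left_id (fpsC (1 : R)) (cauchy *%R).
Proof.
move=> x; rewrite cauchyC; last exact: mul0r.
by apply/fpsP => n; rewrite mul1r.
Qed.

Let fps_mulD : left_distributive (cauchy (@GRing.mul R)) +%R.
Proof. by move=> x y z; rewrite cauchyDl // => v u w; rewrite mulrDl. Qed.

Let fps_1neq0 : fpsC (1 : R) != 0.
Proof.
by apply/eqP => /(congr1 (@^~ 0%N))/= /eqP; rewrite (negbTE (oner_neq0 _)).
Qed.

HB.instance Definition _ := GRing.Zmodule_isComNzRing.Build (fps R)
  fps_mulA fps_mulC fps_mul1 fps_mulD fps_1neq0.

Variable A : lmodType R.

Let fps_scaleA (a b : fps R) (v : fps A) :
  cauchy *:%R a (cauchy *:%R b v) = cauchy *:%R (a * b) v.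
Proof.
symmetry; apply: cauchyA => [w u v'|u v' w|u v' w] /=.
- exact: scalerDl.
- exact: scalerDr.
- by rewrite scalerA.
Qed.

Let fps_scale1 : left_id (1 : fps R) (cauchy (@GRing.scale R A)).
Proof.
move=> x; rewrite cauchyC; last exact: scale0r.
by apply/fpsP => n; rewrite scale1r.
Qed.

Let fps_scaleDr : right_distributive (cauchy (@GRing.scale R A)) +%R.
Proof. by move=> a x y; rewrite cauchyDr // => u v w; rewrite scalerDr. Qed.

Let fps_scaleDl v :
  {morph (cauchy (@GRing.scale R A))^~ v : a b / a + b}.
Proof. by move=> a b; rewrite cauchyDl // => u x y; rewrite scalerDl. Qed.

HB.instance Definition _ := GRing.Zmodule_isLmodule.Build (fps R) (fps A)
  fps_scaleA fps_scale1 fps_scaleDr fps_scaleDl.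

End FpsRing.

(* The k[[t]]-(bi)linear extensions to A[[t]] of \sum_i mu_i t^i and of
   \sum_i T_i t^i. *)
Definition fps_mu (A : zmodType) (mu_ : nat -> A -> A -> A)
    (x y : fps A) : fps A :=
  fun n => \sum_(i < n.+1) cauchy (mu_ i) x y (n - i)%N.

Definition fps_T (A : zmodType) (T_ : nat -> A -> A) (x : fps A) : fps A :=
  fun n => \sum_(i < n.+1) T_ i (x (n - i)%N).

Record formal_deformation (k : fieldType) (A : lmodType k) (lambda : k)
    (mu : A -> A -> A) (T : A -> A)
    (mu_ : nat -> A -> A -> A) (T_ : nat -> A -> A) : Prop :=
  FormalDeformation {
    deformation_bilinear : forall i, bilinear_for *:%R *:%R (mu_ i);
    deformation_linear : forall i, linear (T_ i);
    deformation_rota_baxter :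
      rota_baxter (fpsC lambda) (fps_mu mu_) (fps_T T_);
    deformation_mu0 : mu_ 0%N = mu;
    deformation_T0 : T_ 0%N = T }.

Section CochainComplex.
Variables (k : fieldType) (A : lmodType k).

(* Hom(A^{(x) n}, A) is rendered as the n-linear maps among the functions
   of n arguments a_0, ..., a_{n-1} in A. *)
Definition nmap (n : nat) : Type := ('I_n -> A) -> A.

HB.instance Definition _ n := GRing.Zmodule.copy (nmap n) (('I_n -> A) -> A).

Definition multilinear (n : nat) (f : nmap n) : Prop :=
  forall (a : 'I_n -> A) (i : 'I_n), linear (fun x : A => f (dfwith a (i := i) x)).

Definition args_tail n (a : 'I_n.+1 -> A) : 'I_n -> A :=
  fun j => a (lift ord0 j).

Definition args_init n (a : 'I_n.+1 -> A) : 'I_n -> A :=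
  fun j => a (widen_ord (leqnSn n) j).

(* a_0, ..., a_{i-1}, m a_i a_{i+1}, a_{i+2}, ..., a_n *)
Definition args_merge (m : A -> A -> A) n (i : 'I_n) (a : 'I_n.+1 -> A) :
    'I_n -> A :=
  fun j => if (j < i)%N then args_init a j
           else if j == i then m (args_init a j) (args_tail a j)
           else args_tail a j.

(* The coboundary for a product m and actions l (left) and r (right); as i
   is counted from 0, the sign (-1)^(n - i + 1) becomes (-1)^(n - i). *)
Definition coboundary (m l r : A -> A -> A) n (f : nmap n) : nmap n.+1 :=
  fun a => (-1) ^+ n.+1 *: l (a ord0) (f (args_tail a))
    + \sum_(i < n) (-1) ^+ (n - i) *: f (args_merge m i a)
    + r (f (args_init a)) (a ord_max).

Variables (lambda : k) (mu : A -> A -> A) (T : A -> A).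

Definition delta n : nmap n -> nmap n.+1 := @coboundary mu mu mu n.

Definition star (a b : A) : A := mu a (T b) + mu (T a) b + lambda *: mu a b.
Definition lact (a x : A) : A := mu (T a) x - T (mu a x).
Definition ract (x a : A) : A := mu x (T a) - T (mu x a).

Definition partial n : nmap n -> nmap n.+1 := @coboundary star lact ract n.

Definition args_T n (I : {set 'I_n}) (a : 'I_n -> A) : 'I_n -> A :=
  fun j => if j \in I then T (a j) else a j.

(* The indices i_1 < ... < i_p are given as the p-element set they form. *)
Definition Phi n : nmap n -> nmap n :=
  if n is 0 then id else
  fun f a => f (fun j => T (a j))
    - \sum_(p < n) lambda ^+ (n - p - 1) *:
        \sum_(I : {set 'I_n} | #|I| == p) T (f (args_T I a)).

Definition rba_map (n : nat) : zmodType :=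
  if n is m.+1 then (nmap m.+1 * nmap m)%type else nmap 0.

Definition rba_cochain (n : nat) : rba_map n -> Prop :=
  match n with
  | 0 => fun f => multilinear f
  | m.+1 => fun c => multilinear c.1 /\ multilinear c.2
  end.

(* In degree 0 there is no component g, and d f = (delta f, - Phi f). *)
Definition rba_d (n : nat) : rba_map n -> rba_map n.+1 :=
  match n with
  | 0 => fun f => (delta f, - Phi f)
  | m.+1 => fun c => (delta c.1, - partial c.2 - Phi c.1)
  end.

Definition rba_cocycle (n : nat) (c : rba_map n) : Prop :=
  rba_cochain c /\ rba_d c = 0.

Definition nmap1 (f : A -> A) : nmap 1 := fun a => f (a ord0).
Definition nmap2 (f : A -> A -> A) : nmap 2 := fun a => f (a ord0) (a ord_max).

End CochainComplex.

(* Main.v *)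
Require Import Defs.
From mathcomp Require Import all_boot all_order all_algebra.
From mathcomp Require Import boolp.
Import GRing.Theory.
Local Open Scope ring_scope.

(** The axioms of a Rota-Baxter algebra hold for the deformed operations
    mu_t and T_t on A[[t]]; evaluated at constant series x, y, z : A they are
    equations between power series, and the cocycle condition for
    (mu_1, T_1) is the equality of their coefficients of t.

    - Associativity gives ([deformation_assoc1])
        x mu_1(y, z) + mu_1(x, yz) = mu_1(x, y) z + mu_1(xy, z),
      which is delta mu_1 = 0 ([cocycle_delta]).
    - The Rota-Baxter equation gives ([deformation_rota_baxter1])
        (Tx)(T_1 y) + (T_1 x)(Ty) + mu_1(Tx, Ty)
          = T(x T_1 y) + T((T_1 x) y)
            + lambda T(mu_1(x, y)) + T(mu_1(Tx, y)) + T(mu_1(x, Ty))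
            + T_1(x T(y) + T(x) y + lambda xy).
      The terms with T_1 make up partial T_1 and those with mu_1 make up
      Phi mu_1, so this is partial T_1 + Phi mu_1 = 0
      ([cocycle_partial_Phi]).

    It remains to write the operators of the complex explicitly in the low
    degrees that occur, which is the content of [coboundary1],
    [coboundary2] and [Phi2]. *)

(** * Linear maps given as plain functions *)

Lemma linear_map0 (R : pzRingType) (U V : lmodType R) (g : U -> V) :
  linear g -> g 0 = 0.
Proof.
by move=> lin_g; have := lin_g (-1) 0 0; rewrite scaler0 addr0 scaleN1r addNr.
Qed.

Lemma linear_mapD (R : pzRingType) (U V : lmodType R) (g : U -> V) :
  linear g -> {morph g : x y / x + y}.
Proof. by move=> lin_g x y; have := lin_g 1 x y; rewrite !scale1r. Qed.

Lemma linear_mapZ (R : pzRingType) (U V : lmodType R) (g : U -> V) (c : R) :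
  linear g -> {morph g : x / c *: x}.
Proof.
move=> lin_g x; have := lin_g c x 0.
by rewrite (linear_map0 _ _ _ _ lin_g) !addr0.
Qed.

Arguments linear_map0 {R U V g}.
Arguments linear_mapD {R U V g}.
Arguments linear_mapZ {R U V g}.

(** * Coefficients of the deformed operations *)

Section Coefficients.
Variable A : zmodType.

Lemma fps_mu_coef0 (mu_ : nat -> A -> A -> A) (x y : fps A) :
  fps_mu mu_ x y 0%N = mu_ 0%N (x 0%N) (y 0%N).
Proof. by rewrite /fps_mu /cauchy !big_ord1. Qed.

Lemma fps_mu_coef1 (mu_ : nat -> A -> A -> A) (x y : fps A) :
  fps_mu mu_ x y 1%N = mu_ 0%N (x 0%N) (y 1%N) + mu_ 0%N (x 1%N) (y 0%N)
                       + mu_ 1%N (x 0%N) (y 0%N).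
Proof. by rewrite /fps_mu /cauchy !big_ord_recl !big_ord0 /= !addr0. Qed.

Lemma fps_T_coef0 (T_ : nat -> A -> A) (x : fps A) :
  fps_T T_ x 0%N = T_ 0%N (x 0%N).
Proof. by rewrite /fps_T big_ord1. Qed.

Lemma fps_T_coef1 (T_ : nat -> A -> A) (x : fps A) :
  fps_T T_ x 1%N = T_ 0%N (x 1%N) + T_ 1%N (x 0%N).
Proof. by rewrite /fps_T !big_ord_recl big_ord0 /= addr0. Qed.

End Coefficients.

Lemma fps_add_coef (V : zmodType) (x y : fps V) n : (x + y) n = x n + y n.
Proof. by []. Qed.

Lemma fps_scaleC_coef (R : comNzRingType) (V : lmodType R) (c : R)
    (x : fps V) n :
  (fpsC c *: x) n = c *: x n.
Proof.
rewrite [LHS](_ : _ = cauchy *:%R (fpsC c) x n) //.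
by rewrite cauchyC // => v; rewrite scale0r.
Qed.

(** * The complex in low degrees *)

Section LowDegrees.
Variables (k : fieldType) (A : lmodType k).
Implicit Types (m l r : A -> A -> A) (f : A -> A -> A) (g T : A -> A).

Lemma multilinear_nmap1 g : linear g -> multilinear (nmap1 g).
Proof.
by move=> lin_g a i c x y; rewrite /nmap1 (ord1 i) !dfwith_in lin_g.
Qed.

Lemma multilinear_nmap2 f :
  bilinear_for *:%R *:%R f -> multilinear (nmap2 f).
Proof.
move=> [lin_l lin_r] a i c x y; rewrite /nmap2.
have [->|i0] := eqVneq i ord0.
  by rewrite !dfwith_in !dfwith_out //; exact: lin_l.
have -> : i = ord_max by apply/val_inj; case: i i0 => [[|[|]]].
by rewrite !dfwith_in !dfwith_out //; exact: lin_r.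
Qed.

Lemma coboundary1 m l r g (a : 'I_2 -> A) :
  coboundary m l r (nmap1 g) a =
    l (a ord0) (g (a ord_max)) - g (m (a ord0) (a ord_max))
    + r (g (a ord0)) (a ord_max).
Proof.
rewrite /coboundary big_ord1 sqrrN expr1n scale1r subn0 scaleN1r.
rewrite /nmap1 /args_merge /args_tail /args_init /=.
have -> : lift ord0 ord0 = ord_max :> 'I_2 by exact: val_inj.
by have -> : widen_ord (leqnSn 1) ord0 = ord0 by exact: val_inj.
Qed.

Lemma coboundary2 m l r f (a : 'I_3 -> A) :
  let x := a ord0 in let y := a (inord 1) in let z := a ord_max in
  coboundary m l r (nmap2 f) a =
    - l x (f y z) + f (m x y) z - f x (m y z) + r (f x y) z.
Proof.
have t0 : lift ord0 ord0 = inord 1 :> 'I_3 by apply: val_inj; rewrite /= inordK.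
have t1 : lift ord0 ord_max = ord_max :> 'I_3 by exact: val_inj.
have i0 : widen_ord (leqnSn 2) ord0 = ord0 by exact: val_inj.
have i1 : widen_ord (leqnSn 2) ord_max = inord 1.
  by apply: val_inj; rewrite /= inordK.
rewrite /= /coboundary !big_ord_recl big_ord0 /= addr0.
rewrite /nmap2 /args_merge /args_tail /args_init /= t0 t1 i0 i1.
by rewrite exprS sqrrN expr1n mulr1 !scaleN1r scale1r !addrA.
Qed.

Lemma sum_card1 (V : zmodType) (I : finType) (F : {set I} -> V) :
  \sum_(J : {set I} | #|J| == 1%N) F J = \sum_(i : I) F [set i].
Proof.
rewrite -(big_imset (h := set1) (A := I) F) /=; last first.
  by move=> i j _ _; exact: set1_inj.
by apply: eq_bigl => J; apply/cards1P/imsetP => [[i ->]|[i _ ->]]; exists i.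
Qed.

Lemma Phi2 (lambda : k) T f (a : 'I_2 -> A) :
  let x := a ord0 in let y := a ord_max in
  Phi lambda T (nmap2 f) a =
    f (T x) (T y) - (lambda *: T (f x y) + (T (f (T x) y) + T (f x (T y)))).
Proof.
rewrite /= /Phi !big_ord_recl big_ord0 /= addr0.
(* p = 0 leaves the empty index set, p = 1 the two singletons. *)
rewrite (big_pred1 set0) => [|J]; last by rewrite cards_eq0.
rewrite sum_card1 !big_ord_recl big_ord0 addr0 /nmap2 /args_T.
by rewrite expr0 expr1 scale1r !inE !eqxx.
Qed.

End LowDegrees.

(** * The two components of the cocycle condition *)

Section Cocycle.
Variables (k : fieldType) (A : lmodType k) (lambda : k).
Variables (mu : A -> A -> A) (T : A -> A).
Variables (mu_ : nat -> A -> A -> A) (T_ : nat -> A -> A).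
Hypothesis defA : formal_deformation lambda mu T mu_ T_.

Let mu0l x : mu 0 x = 0.
Proof.
rewrite -(deformation_mu0 defA).
have [lin_mul _] := deformation_bilinear defA 0.
by have := linear_map0 (lin_mul x).
Qed.

Let mu0r x : mu x 0 = 0.
Proof.
rewrite -(deformation_mu0 defA).
have [_ lin_mul] := deformation_bilinear defA 0.
by have := linear_map0 (lin_mul x).
Qed.

Let lin_T : linear T.
Proof.
by rewrite -(deformation_T0 defA); exact: deformation_linear defA 0%N.
Qed.

(** This is the coefficient of t in the associativity of mu_t on constant
    series; a constant has no coefficient of t, so every term in which that
    coefficient enters vanishes. *)
Lemma deformation_assoc1 x y z :
  mu x (mu_ 1%N y z) + mu_ 1%N x (mu y z)
    = mu (mu_ 1%N x y) z + mu_ 1%N (mu x y) z.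
Proof.
have := congr1 (@^~ 1%N) (rota_baxter_assoc (deformation_rota_baxter defA)
  (fpsC x) (fpsC y) (fpsC z)).
rewrite /= !fps_mu_coef1 !fps_mu_coef0 /= (deformation_mu0 defA).
by rewrite !(mu0l, mu0r) !(add0r, addr0).
Qed.

(** This is the coefficient of t in the Rota-Baxter equation for mu_t and
    T_t on constant series.  The linearity of T splits the right-hand side,
    so that every term belongs either to partial T_1 or to Phi mu_1. *)
Lemma deformation_rota_baxter1 x y :
  mu (T x) (T_ 1%N y) + mu (T_ 1%N x) (T y) + mu_ 1%N (T x) (T y)
  = T (mu x (T_ 1%N y)) + T (mu (T_ 1%N x) y)
    + (lambda *: T (mu_ 1%N x y) + T (mu_ 1%N (T x) y) + T (mu_ 1%N x (T y)))
    + T_ 1%N (star lambda mu T x y).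
Proof.
have := congr1 (@^~ 1%N) (rota_baxter_eq (deformation_rota_baxter defA)
  (fpsC x) (fpsC y)).
rewrite /= !(fps_mu_coef1, fps_T_coef1, fps_mu_coef0, fps_T_coef0,
             fps_add_coef, fps_scaleC_coef) /=.
rewrite (deformation_mu0 defA) (deformation_T0 defA).
rewrite (linear_map0 lin_T) !(mu0l, mu0r) !(add0r, addr0) => ->.
congr (_ + _).
rewrite !(linear_mapD lin_T) (linear_mapZ _ lin_T).
by rewrite !addrA [LHS](ACl (1*3*5*4*2)).
Qed.

Lemma cocycle_delta : delta mu (nmap2 (mu_ 1%N)) = 0.
Proof.
apply/funext => a; rewrite /delta coboundary2 /=.
set x := a ord0; set y := a _; set z := a ord_max.
transitivity (mu (mu_ 1%N x y) z + mu_ 1%N (mu x y) z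
              - (mu x (mu_ 1%N y z) + mu_ 1%N x (mu y z))).
  by rewrite opprD !addrA [LHS](ACl (4*2*1*3)).
by rewrite deformation_assoc1 subrr.
Qed.

Lemma cocycle_partial_Phi :
  - partial lambda mu T (nmap1 (T_ 1%N)) - Phi lambda T (nmap2 (mu_ 1%N)) = 0.
Proof.
rewrite -opprD; apply/eqP; rewrite oppr_eq0; apply/eqP/funext => a.
transitivity (partial lambda mu T (nmap1 (T_ 1%N)) a
              + Phi lambda T (nmap2 (mu_ 1%N)) a) => //.
rewrite Phi2 /partial coboundary1 /lact /ract /=.
have /eqP := deformation_rota_baxter1 (a ord0) (a ord_max).
rewrite -subr_eq0 => /eqP; rewrite !opprD !addrA => eq0.
rewrite -[RHS]eq0.
by rewrite [LHS](ACl (1*4*6*2*5*7*8*9*3)).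
Qed.

End Cocycle.

Theorem proposition6p2 (k : fieldType) (char0 : [pchar k] =i pred0)
    (lambda : k) (A : lmodType k) (mu : A -> A -> A) (T : A -> A)
    (mu_ : nat -> A -> A -> A) (T_ : nat -> A -> A)
    (rbA : rota_baxter lambda mu T)
    (defA : formal_deformation lambda mu T mu_ T_) :
  rba_cocycle (n := 2) lambda mu T (nmap2 (mu_ 1%N), nmap1 (T_ 1%N)).
Proof.
split; first split.
- exact: multilinear_nmap2 (deformation_bilinear defA 1%N).
- exact: multilinear_nmap1 (deformation_linear defA 1%N).
rewrite /rba_d /=.
rewrite (cocycle_delta _ _ _ _ _ _ _ defA).
by rewrite (cocycle_partial_Phi _ _ _ _ _ _ _ defA).
Qed.
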